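(* Let $S=S_1\sqcup S_2$ with $|S_1|=2$, $|S_2|=3$, let $(S,E)$ be the complete bipartite graph on $S$ with parts $S_1,S_2$, and let $\mathcal{N}=V\oplus W$ be the $2$-step nilpotent real Lie algebra associated with $(S,E)$. Let $\mathfrak{n}=V\oplus V\oplus W$ be the $16$-dimensional real Lie algebra with bracket $$[(x_1,x_2,w),(y_1,y_2,w')]=(0,0,[x_1,y_1]+[x_2,y_2]),\qquad x_i,y_i\in V,\ w,w'\in W,$$ where $[x_i,y_i]\in W$ is the bracket in $\mathcal{N}$. Then $\mathfrak{n}$ is indecomposable.
   Context: The $2$-step nilpotent Lie algebra associated with a finite simple graph $(S,E)$ is $\mathcal{N}=V\oplus W$, where $V$ is the real vector space with basis $S$ and $W$ is the subspace of $\wedge^2 V$ spanned by $\{\alpha\wedge\beta : \alpha,\beta\in S,\ \alpha\beta\in E\}$; the bracket is determined by $[\alpha,\beta]=\alpha\wedge\beta$ if $\alpha\beta\in E$, $[\alpha,\beta]=0$ if $\alpha,\beta\in S$ are not adjacent, and $[\mathcal{N},W]=0$. A Lie algebra is indecomposable if it cannot be expressed as a direct sum of proper Lie ideals. *)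

(* Defs.v *)
From HB Require Import structures.
From mathcomp Require Import all_boot all_order all_algebra.
From mathcomp Require Import reals.

Set Implicit Arguments.
Unset Strict Implicit.
Unset Printing Implicit Defensive.

Import GRing.Theory.
Local Open Scope ring_scope.

HB.mixin Record isLieAlgebra (K : fieldType) L of Vector K L := {
  lie : L -> L -> L;
  lie_linearl : forall z : L, linear (fun x => lie x z);
  lie_linearr : forall z : L, linear (lie z);
  liexx : forall x : L, lie x x = 0;
  lie_jacobi : forall x y z : L,
    lie x (lie y z) + lie y (lie z x) + lie z (lie x y) = 0
}.

#[short(type="lieAlgType")]
HB.structure Definition LieAlgebra (K : fieldType) :=
  { L of isLieAlgebra K L & Vector K L }.

Definition lie_ideal (K : fieldType) (L : lieAlgType K) (I : {vspace L}) :=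
  forall x y : L, y \in I -> lie x y \in I.

(* [I] and [J] are then nonzero, each being a complement of the other. *)
Definition lie_decomposable (K : fieldType) (L : lieAlgType K) :=
  exists I J : {vspace L},
    [/\ lie_ideal I, lie_ideal J, I != fullv, J != fullv &
        (I + J)%VS = fullv /\ (I :&: J)%VS = 0%VS].

Definition lie_indecomposable (K : fieldType) (L : lieAlgType K) :=
  ~ lie_decomposable L.

Record sgraph := SGraph {
  vertex :> finType;
  edge : rel vertex;
  edge_sym : symmetric edge;
  edge_irrefl : irreflexive edge
}.

Definition complete_bipartite (G : sgraph) (S1 S2 : {set G}) :=
  [/\ S1 :|: S2 = [set: G], [disjoint S1 & S2] &
      forall a b : G, edge a b =
        (a \in S1) && (b \in S2) || (a \in S2) && (b \in S1)].

Section GraphLie.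
Variables (R : realType) (G : sgraph).

Local Notation Vsp := {ffun G -> R^o}.

Definition vtx (a : G) : Vsp := [ffun b => (a == b)%:R].

(* The exterior square of [Vsp] is realized, as usual in characteristic zero,
   as the skew-symmetric tensors inside [Vsp (x) Vsp] = functions on [G * G],
   with [u /\ v = u (x) v - v (x) u]. *)
Local Notation tensor2 := {ffun G * G -> R^o}.

Definition wedge (u v : Vsp) : tensor2 :=
  [ffun p => u p.1 * v p.2 - v p.1 * u p.2].

Definition Wspace : {vspace tensor2} :=
  <<[seq wedge (vtx p.1) (vtx p.2) | p : G * G in [pred p | edge p.1 p.2]]>>%VS.

Local Notation Wsp := (subvs_of Wspace).

(* [vsproj Wspace] only casts to [Wsp]: see [vtx_lieE]. *)
Definition vtx_lie (a b : G) : Wsp :=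
  if edge a b then vsproj Wspace (wedge (vtx a) (vtx b)) else 0.

Lemma vtx_lieE (a b : G) :
  vsval (vtx_lie a b) = if edge a b then wedge (vtx a) (vtx b) else 0.
Proof.
rewrite /vtx_lie; case: ifP => // eab.
rewrite vsprojK //; apply: memv_span; apply/mapP; exists (a, b) => //.
by rewrite mem_enum.
Qed.

Definition V_lie (u v : Vsp) : Wsp :=
  \sum_(a : G) \sum_(b : G) (u a * v b) *: vtx_lie a b.

Lemma V_lie_vtx (a b : G) : V_lie (vtx a) (vtx b) = vtx_lie a b.
Proof.
rewrite /V_lie (bigD1 a) //= [X in _ + X]big1 => [|c ca]; last first.
  by rewrite big1 // => d _; rewrite ffunE eq_sym (negPf ca) mul0r scale0r.
rewrite (bigD1 b) //= [X in _ + X + _]big1 => [|c cb]; last first.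
  by rewrite [X in _ * X]ffunE eq_sym (negPf cb) mulr0 scale0r.
by rewrite !ffunE !eqxx mulr1 scale1r !addr0.
Qed.

Lemma V_lie_linearl (v : Vsp) : linear (fun u => V_lie u v).
Proof.
move=> k u u'; rewrite /V_lie scaler_sumr -big_split; apply: eq_bigr => a _.
rewrite scaler_sumr -big_split; apply: eq_bigr => b _ /=.
by rewrite !ffunE scalerA mulrDl scalerDl mulrA.
Qed.

Lemma V_lie_linearr (u : Vsp) : linear (V_lie u).
Proof.
move=> k v v'; rewrite /V_lie scaler_sumr -big_split; apply: eq_bigr => a _.
rewrite scaler_sumr -big_split; apply: eq_bigr => b _ /=.
by rewrite !ffunE scalerA mulrDr scalerDl mulrCA.
Qed.

Lemma vtx_lieC (a b : G) : vtx_lie a b = - vtx_lie b a.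
Proof.
apply: val_inj; rewrite [RHS]raddfN /=.
have := vtx_lieE a b; have := vtx_lieE b a => /= -> ->.
rewrite edge_sym; case: ifP => _; last by rewrite oppr0.
by apply/ffunP => p; rewrite !ffunE opprB.
Qed.

Lemma V_liexx (u : Vsp) : V_lie u u = 0.
Proof.
have H : V_lie u u = - V_lie u u.
  rewrite {1}/V_lie exchange_big /= /V_lie -sumrN; apply: eq_bigr => a _.
  rewrite -sumrN; apply: eq_bigr => b _.
  by rewrite vtx_lieC scalerN mulrC.
have : 2%:R *: V_lie u u = 0 by rewrite scaler_nat mulr2n {1}H addNr.
by move/eqP; rewrite scaler_eq0 Num.Theory.pnatr_eq0 /= => /eqP.
Qed.

Lemma V_lie0 (u : Vsp) : V_lie u 0 = 0.
Proof.
by rewrite /V_lie big1 // => a _; rewrite big1 // => b _; rewrite ffunE mulr0 scale0r.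
Qed.

Definition graph_lie : Type := (Vsp * Wsp)%type.
HB.instance Definition _ := Vector.on graph_lie.

Definition graph_lie_br (x y : graph_lie) : graph_lie := (0, V_lie x.1 y.1).

Lemma graph_lie_linearl z : linear (fun x => graph_lie_br x z).
Proof.
move=> k x y; rewrite /graph_lie_br /= V_lie_linearl.
by congr pair; rewrite /= scaler0 addr0.
Qed.

Lemma graph_lie_linearr z : linear (graph_lie_br z).
Proof.
move=> k x y; rewrite /graph_lie_br /= V_lie_linearr.
by congr pair; rewrite /= scaler0 addr0.
Qed.

Lemma graph_liexx x : graph_lie_br x x = 0.
Proof. by rewrite /graph_lie_br V_liexx. Qed.

Lemma graph_lie_jacobi x y z :
  graph_lie_br x (graph_lie_br y z) + graph_lie_br y (graph_lie_br z x)
    + graph_lie_br z (graph_lie_br x y) = 0.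
Proof.
have H u v w : graph_lie_br u (graph_lie_br v w) = 0.
  by rewrite {1}/graph_lie_br V_lie0.
by rewrite !H !addr0.
Qed.

HB.instance Definition _ := isLieAlgebra.Build R graph_lie
  graph_lie_linearl graph_lie_linearr graph_liexx graph_lie_jacobi.

(* The bracket of [N = V (+) W] restricted to [V], with values in [W]. *)
Definition N_lie (u v : Vsp) : Wsp :=
  (lie ((u, 0) : graph_lie) ((v, 0) : graph_lie)).2.

Definition double_lie : Type := (Vsp * Vsp * Wsp)%type.
HB.instance Definition _ := Vector.on double_lie.

Definition double_lie_br (x y : double_lie) : double_lie :=
  let: (x1, x2, _) := x in let: (y1, y2, _) := y in
  (0, 0, N_lie x1 y1 + N_lie x2 y2).

Lemma double_lie_linearl z : linear (fun x => double_lie_br x z).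
Proof.
case: z => [[z1 z2] z3] k [[x1 x2] x3] [[y1 y2] y3].
rewrite /double_lie_br /N_lie /= !V_lie_linearl addrACA -scalerDr.
by congr (_, _, _); rewrite /= scaler0 addr0.
Qed.

Lemma double_lie_linearr z : linear (double_lie_br z).
Proof.
case: z => [[z1 z2] z3] k [[x1 x2] x3] [[y1 y2] y3].
rewrite /double_lie_br /N_lie /= !V_lie_linearr addrACA -scalerDr.
by congr (_, _, _); rewrite /= scaler0 addr0.
Qed.

Lemma double_liexx x : double_lie_br x x = 0.
Proof.
by case: x => [[x1 x2] x3]; rewrite /double_lie_br /N_lie /= !V_liexx addr0.
Qed.

Lemma double_lie_jacobi x y z :
  double_lie_br x (double_lie_br y z) + double_lie_br y (double_lie_br z x)
    + double_lie_br z (double_lie_br x y) = 0.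
Proof.
have H u v w : double_lie_br u (double_lie_br v w) = 0.
  case: u v w => [[u1 u2] u3] [[v1 v2] v3] [[w1 w2] w3].
  by rewrite /double_lie_br /N_lie /= !V_lie0 addr0.
by rewrite !H !addr0.
Qed.

HB.instance Definition _ := isLieAlgebra.Build R double_lie
  double_lie_linearl double_lie_linearr double_liexx double_lie_jacobi.

End GraphLie.

(* Main.v *)
Require Import Defs.
From HB Require Import structures.
From mathcomp Require Import all_boot all_order all_algebra.
From mathcomp Require Import reals.

(** A decomposition [I (+) J] of a Lie algebra yields the projection [p] onto
[I] along [J], which lies in the centroid: [p [x, y] = [p x, y]].  For the
algebra at hand, comparing coordinates in [[p a, b] = p [a, b] = [a, p b]],
with [a] and [b] vertices in the first copy of [V] on opposite sides of the
graph, shows that every element of the centroid acts on the center [W] by one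
scalar.  For a projection this scalar is 0 or 1, so one of the summands meets
the center trivially; in a 2-step nilpotent algebra such an ideal is zero. *)

Set Implicit Arguments.
Unset Strict Implicit.
Unset Printing Implicit Defensive.

Import GRing.Theory.
Local Open Scope ring_scope.

(** * Centroids and direct sums of ideals *)

Section Centroid.
Variables (K : fieldType) (L : lieAlgType K).
Implicit Types (x y z : L) (p : 'End(L)) (I J : {vspace L}).

Definition centroid p := forall x y, p (lie x y) = lie (p x) y.

Definition lie_central z := forall y, lie z y = 0.

Lemma lieDl x y z : lie (x + y) z = lie x z + lie y z.
Proof. by have := lie_linearl z 1 x y; rewrite !scale1r. Qed.

Lemma lieDr x y z : lie z (x + y) = lie z x + lie z y.
Proof. by have := lie_linearr z 1 x y; rewrite !scale1r. Qed.

Lemma lieC x y : lie x y = - lie y x.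
Proof.
by apply/eqP; rewrite -addr_eq0 -(liexx (x + y)) lieDl !lieDr !liexx add0r addr0.
Qed.

Lemma centroidr p x y : centroid p -> p (lie x y) = lie x (p y).
Proof. by move=> cp; rewrite lieC linearN /= cp -lieC. Qed.

(** With [p] the projection onto [I] and [q] the one onto [J], split [[x, y] = [p x, y] + [q x, y]]:
    the first term lies in [I] and is fixed by [p], the second lies in [J] and is killed. *)
Lemma ideal_projection_centroid I J : lie_ideal I -> lie_ideal J ->
  (I + J)%VS = fullv -> (I :&: J)%VS = 0%VS -> centroid (daddv_pi I J).
Proof.
move=> idI idJ IJ1 IJ0 x y.
have JI0 : (J :&: I)%VS = 0%VS by rewrite capvC.
have dec z : daddv_pi I J z + daddv_pi J I z = z.
  by apply: daddv_pi_add => //; rewrite IJ1 memvf.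
have idIl z : z \in I -> lie z y \in I by move=> zI; rewrite lieC memvN idI.
have idJl z : z \in J -> lie z y \in J by move=> zJ; rewrite lieC memvN idJ.
rewrite -{1}[x]dec lieDl linearD /=.
rewrite [daddv_pi I J (lie _ _)]daddv_pi_id ?idIl ?memv_pi //.
set u := lie (daddv_pi J I x) y.
have uJ : daddv_pi J I u = u by rewrite daddv_pi_id // idJl ?memv_pi.
have := dec u; rewrite uJ => /eqP; rewrite -subr_eq0 addrK => /eqP ->.
by rewrite addr0.
Qed.

(** For [x] in [I], the brackets of [x] are central and lie in [I], so each equals its own
    projection, which is zero. Thus [x] is itself central, and vanishes for the same reason. *)
Lemma centerless_ideal_complement I J :
  (forall x y, lie_central (lie x y)) -> lie_ideal I -> (I + J)%VS = fullv ->
  (I :&: J)%VS = 0%VS -> (forall z, lie_central z -> daddv_pi I J z = 0) ->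
  J = fullv.
Proof.
move=> nil2 idI IJ1 IJ0 pi0.
suff I0 x : x \in I -> x = 0.
  rewrite -IJ1; have -> : I = 0%VS; last by rewrite add0v.
  by apply/eqP; rewrite -subv0; apply/subvP => x /I0 ->; rewrite mem0v.
move=> xI; rewrite -(daddv_pi_id IJ0 xI) pi0 // => y.
by rewrite -(@daddv_pi_id _ _ I J (lie x y)) ?pi0 // lieC memvN idI.
Qed.

Lemma scalar_centroid_indecomposable :
    (forall x y, lie_central (lie x y)) ->
    (exists2 z, lie_central z & z != 0) ->
    (forall p, centroid p ->
       exists t, forall z, lie_central z -> p z = t *: z) ->
  lie_indecomposable L.
Proof.
move=> nil2 [z zC z_neq0] scal [I [J [idI idJ IT JT [IJ1 IJ0]]]].
have [t tP] := scal _ (ideal_projection_centroid idI idJ IJ1 IJ0).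
(* A projection is idempotent; evaluate at the nonzero central [z]. *)
have: t * t - t = 0.
  apply/eqP; move: z_neq0; apply: contraNT => tt.
  have := daddv_pi_proj z IJ0; rewrite (tP z zC) linearZ /= (tP z zC) scalerA.
  by move/eqP; rewrite -subr_eq0 -scalerBl scaler_eq0 (negPf tt).
rewrite -{3}[t]mulr1 -mulrBr => /eqP; rewrite mulf_eq0 subr_eq0.
case/orP => /eqP t01; subst t.
  case/eqP: JT; apply: centerless_ideal_complement nil2 idI IJ1 IJ0 _ => u uC.
  by rewrite tP // scale0r.
(* For [t = 1] the roles are exchanged: the projection onto [J] kills the center. *)
have JI0 : (J :&: I)%VS = 0%VS by rewrite capvC.
case/eqP: IT; apply: centerless_ideal_complement nil2 idJ _ JI0 _ => [|u uC].
  by rewrite addvC.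
have : daddv_pi I J u + daddv_pi J I u = u.
  by apply: daddv_pi_add => //; rewrite IJ1 memvf.
by rewrite tP // scale1r => /eqP; rewrite addrC -subr_eq0 addrK => /eqP.
Qed.

End Centroid.

(** * Brackets, center and centroid of the doubled graph algebra *)

Section GraphLieTheory.
Variables (R : realType) (G : sgraph).

Local Notation Vsp := {ffun G -> R^o}.
Local Notation Wsp := (subvs_of (Wspace R G)).

(** The bracket is the tensor [wedge u v] with its entries off the edges erased, so equalities in
    [W] can be checked entry by entry. *)
Lemma vsval_V_lie (u v : Vsp) (c d : G) :
  vsval (V_lie u v) (c, d) = if edge c d then u c * v d - v c * u d else 0.
Proof.
have delta (f : G -> R) e : \sum_a f a * (a == e)%:R = f e.
  rewrite (bigD1 e) //= eqxx mulr1 big1 ?addr0 // => a /negPf ->.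
  by rewrite mulr0.
have delta2 e f : \sum_a \sum_b u a * v b * ((a == e)%:R * (b == f)%:R) = u e * v f.
  rewrite -[RHS](delta (fun a => u a * v f)); apply: eq_bigr => a _.
  rewrite -[RHS](delta (fun b => u a * v b * (a == e)%:R)); apply: eq_bigr => b _.
  by rewrite !mulrA.
have edgeE a b : vsval (vtx_lie R a b) (c, d) = (edge c d)%:R *
    ((a == c)%:R * (b == d)%:R - (a == d)%:R * (b == c)%:R).
  have -> : vsval (vtx_lie R a b) (c, d) = (edge a b)%:R *
      ((a == c)%:R * (b == d)%:R - (a == d)%:R * (b == c)%:R).
    rewrite vtx_lieE [_ * (b == c)%:R]mulrC.
    by case: ifP => _; rewrite !ffunE ?mul1r ?mul0r.
  (* The deltas force [(a, b)] to be [(c, d)] or [(d, c)], so by symmetry of [edge] the factor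
     [edge a b] can be traded for [edge c d]. *)
  have edge_delta e f : edge e f = edge c d -> (edge a b)%:R *
      ((a == e)%:R * (b == f)%:R) = (edge c d)%:R * ((a == e)%:R * (b == f)%:R) :> R.
    move=> eq_edge; have [-> | _] := eqVneq a e; last by rewrite !(mul0r, mulr0).
    by have [-> | _] := eqVneq b f; rewrite ?eq_edge // !mulr0.
  by rewrite !mulrBr !edge_delta // edge_sym.
rewrite /V_lie linear_sum sum_ffunE /=.
transitivity ((edge c d)%:R * (u c * v d - u d * v c)); last first.
  by case: ifP => _; rewrite ?mul0r // mul1r [u d * _]mulrC.
rewrite -!delta2 -sumrB mulr_sumr; apply: eq_bigr => a _.
rewrite linear_sum sum_ffunE -sumrB mulr_sumr; apply: eq_bigr => b _.
by rewrite linearZ ffunE /= edgeE -mulrBr [RHS]mulrCA.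
Qed.

Lemma double_lieE (x y : double_lie R G) :
  lie x y = (0, 0, V_lie x.1.1 y.1.1 + V_lie x.1.2 y.1.2) :> double_lie R G.
Proof. by case: x y => [[x1 x2] x3] [[y1 y2] y3]. Qed.

Lemma double_lie_nil2 (x y : double_lie R G) : lie_central (lie x y).
Proof.
by move=> z; rewrite lieC [lie x y]double_lieE double_lieE /= !V_lie0 addr0 oppr0.
Qed.

Lemma V_lie0l (v : Vsp) : V_lie 0 v = 0.
Proof. by have := V_lie_linearl v (-1) v v; rewrite !scaleN1r !addNr. Qed.

Lemma W_ind (Q : Wsp -> Prop) :
    Q 0 -> (forall k w w', Q w -> Q w' -> Q (k *: w + w')) ->
    (forall a b : G, edge a b -> Q (vtx_lie R a b)) ->
  forall w, Q w.
Proof.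
move=> Q0 Qlin Qedge w.
set X := [seq wedge (vtx R p.1) (vtx R p.2) | p : G * G in [pred p | edge p.1 p.2]].
(* The family lists every edge in both orientations; [coord] selects one expansion over it. *)
have -> : w = \sum_(i < size X) coord (in_tuple X) i (vsval w) *: vsproj _ X`_i.
  apply: val_inj; rewrite /= linear_sum.
  rewrite {1}(@coord_span _ _ _ (in_tuple X) _ (valP w)).
  apply: eq_bigr => i _; rewrite linearZ /= vsprojK //.
  by apply: memv_span; apply: mem_nth.
elim/big_rec: _ => // i w' _; apply: Qlin.
have /mapP[[a b]] : X`_i \in X by apply: mem_nth.
rewrite mem_enum inE => /= eab ->; have := Qedge a b eab.
by rewrite /vtx_lie eab.
Qed.

Definition in_first (u : Vsp) : double_lie R G := (u, 0, 0).
Definition in_second (u : Vsp) : double_lie R G := (0, u, 0).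
Definition in_W (w : Wsp) : double_lie R G := (0, w).

Lemma in_W_linear : linear in_W.
Proof. by move=> k w w'; congr (_, _); rewrite /= scaler0 addr0. Qed.

HB.instance Definition _ :=
  GRing.isLinear.Build R Wsp (double_lie R G) _ in_W in_W_linear.

(** If [b] is adjacent to [a], the [(a, b)] entry of the bracket of [u] with the vertex [b] is
    [u a], so a [u] that brackets to zero with all of [V] vanishes. Testing [z] against each copy of
    [V] isolates its two components. *)
Lemma double_lie_central (z : double_lie R G) :
  (forall a : G, exists b, edge a b) -> lie_central z <-> z.1 = 0.
Proof.
move=> noiso; split=> [zC | z0 y]; last first.
  by rewrite lieC double_lieE z0 /= !V_lie0 addr0 oppr0.
have coord0 (u : Vsp) : (forall v : Vsp, V_lie u v = 0) -> u = 0.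
  move=> u0; apply/ffunP => a; rewrite ffunE; have [b eab] := noiso a.
  have /(congr1 (fun w : Wsp => vsval w (a, b))) := u0 (vtx R b).
  have /negPf ba : b != a by apply: contraTneq eab => ->; rewrite edge_irrefl.
  by rewrite vsval_V_lie eab !ffunE eqxx ba mulr1 mul0r subr0.
have proj2 (x y : double_lie R G) : x = y -> x.2 = y.2 by move->.
case: z zC => [[z1 z2] w] /= zC; congr (_, _); apply: coord0 => v.
  by have /proj2 := zC (in_first v); rewrite double_lieE /= V_lie0 addr0.
by have /proj2 := zC (in_second v); rewrite double_lieE /= V_lie0 add0r.
Qed.

(** A bracket is a skew-symmetric tensor vanishing off the edges, so its [S1]-by-[S2] block
    determines it. *)
Lemma eq_V_lie_bipartite (S1 S2 : {set G}) (u u' v v' : Vsp) :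
  complete_bipartite S1 S2 ->
  (forall c d, c \in S1 -> d \in S2 ->
    u c * v d - v c * u d = u' c * v' d - v' c * u' d) ->
  V_lie u v = V_lie u' v'.
Proof.
move=> [_ _ edgeE] eq12; apply: val_inj; apply/ffunP => -[c d].
rewrite [LHS]vsval_V_lie [RHS]vsval_V_lie.
case: ifP; rewrite // edgeE => /orP[] /andP[cS dS]; first exact: eq12.
apply: oppr_inj; rewrite !opprB.
rewrite [v c * _]mulrC [u c * _]mulrC [v' c * _]mulrC [u' c * _]mulrC.
exact: eq12.
Qed.

Lemma centroid_scalar_on_W (S1 S2 : {set G}) (p : 'End(double_lie R G)) :
  complete_bipartite S1 S2 -> S1 != set0 -> S2 != set0 -> centroid p ->
  exists t, forall w : Wsp, p (in_W w) = t *: in_W w.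
Proof.
move=> bip /set0Pn[a0 a0S] /set0Pn[b0 b0S] cp; have [_ dis edgeE] := bip.
have neq12 a b : a \in S1 -> b \in S2 -> (b == a) = false.
  by move=> aS bS; apply: contraTF bS => /eqP ->; rewrite (disjointFr dis aS).
(* Bracketing with the first copy of [V] sees only this component of the image. *)
pose P a : Vsp := (p (in_first (vtx R a))).1.1.
have pl a b : p (in_W (vtx_lie R a b)) = in_W (V_lie (P a) (vtx R b)).
  have := cp (in_first (vtx R a)) (in_first (vtx R b)).
  by rewrite !double_lieE /= !V_lie0 !addr0 V_lie_vtx.
have pr a b : p (in_W (vtx_lie R a b)) = in_W (V_lie (vtx R a) (P b)).
  have := centroidr (in_first (vtx R a)) (in_first (vtx R b)) cp.
  by rewrite !double_lieE /= V_lie0 V_lie0l !addr0 V_lie_vtx.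
(* Vertices on opposite sides are distinct, so in the [(c, d)] entry of each bracket one of the two
   products drops out. *)
have Pcoord a b c d : a \in S1 -> b \in S2 -> c \in S1 -> d \in S2 ->
    P a c * (b == d)%:R = (a == c)%:R * P b d.
  move=> aS bS cS dS; have := pr a b; rewrite pl.
  move=> /(congr1 (fun z : double_lie R G => vsval z.2 (c, d))) /=.
  rewrite !vsval_V_lie edgeE cS dS /= !ffunE.
  by rewrite (neq12 _ _ cS bS) [a == d]eq_sym (neq12 _ _ aS dS) mul0r mulr0 !subr0.
pose t := P a0 a0; exists t.
(* Taking [c = a] and [d = b] equates diagonal entries across the two sides, hence all of them equal
   [t]. *)
have Pdiag a b : a \in S1 -> b \in S2 -> P a a = P b b.
  by move=> aS bS; have := Pcoord _ _ _ _ aS bS aS bS; rewrite !eqxx mulr1 mul1r.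
have PE a c : a \in S1 -> c \in S1 -> P a c = t * (a == c)%:R.
  move=> aS cS; have := Pcoord _ _ _ _ aS b0S cS b0S; rewrite eqxx mulr1 => ->.
  by rewrite -(Pdiag _ _ a0S b0S) mulrC.
have edge12 a b : a \in S1 -> b \in S2 ->
    p (in_W (vtx_lie R a b)) = t *: in_W (vtx_lie R a b).
  move=> aS bS; rewrite pl.
  (* [P a] agrees with [t *: vtx R a] on [S1] only, but its entries on [S2] do not affect the
     bracket with a vertex of [S2]. *)
  have -> : V_lie (P a) (vtx R b) = V_lie (t *: vtx R a) (vtx R b).
    apply: (eq_V_lie_bipartite bip) => c d cS dS.
    by rewrite !ffunE (neq12 _ _ cS bS) !mul0r PE.
  have := V_lie_linearl (vtx R b) t (vtx R a) 0.
  by rewrite V_lie0l !addr0 V_lie_vtx => ->; rewrite linearZ.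
apply: W_ind => [|k w w' pw pw'|a b].
- by rewrite !linear0.
- by rewrite !linearP /= pw pw'.
rewrite edgeE => /orP[] /andP[aS bS]; first exact: edge12.
by rewrite vtx_lieC !linearN /= edge12 // scalerN.
Qed.

End GraphLieTheory.

Theorem proposition4p1 (R : realType) (G : sgraph) (S1 S2 : {set G})
    (hG : complete_bipartite S1 S2) (hS1 : #|S1| = 2) (hS2 : #|S2| = 3) :
  lie_indecomposable (double_lie R G : lieAlgType R).
Proof.
have S1n0 : S1 != set0 by rewrite -card_gt0 hS1.
have S2n0 : S2 != set0 by rewrite -card_gt0 hS2.
have [/set0Pn[a aS] /set0Pn[b bS]] := (S1n0, S2n0).
have [cov dis edgeE] := hG.
have noiso (c : G) : exists d, edge c d.
  have: c \in S1 :|: S2 by rewrite cov inE.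
  case/setUP => cS; [exists b | exists a]; by rewrite edgeE ?aS ?bS cS ?orbT.
have centralE (z : double_lie R G) : lie_central z <-> z.1 = 0.
  exact: double_lie_central.
apply: scalar_centroid_indecomposable.
- exact: double_lie_nil2.
(* The bracket along an edge is nonzero: its entry at that edge is 1. *)
- exists (in_W (vtx_lie R a b)); first by apply/centralE.
  apply/eqP => /(congr1 (fun z : double_lie R G => vsval z.2 (a, b))) /=.
  rewrite -V_lie_vtx vsval_V_lie edgeE aS bS !ffunE /= !eqxx.
  have -> : (b == a) = false.
    by apply: contraTF bS => /eqP ->; rewrite (disjointFr dis aS).
  by rewrite mulr1 mul0r subr0 => /eqP; rewrite oner_eq0.
(* By [centralE] the center is exactly the image of [in_W]. *)
move=> p /(centroid_scalar_on_W hG S1n0 S2n0)[t pt]; exists t.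
by move=> [z w] /centralE /= ->; exact: pt.
Qed.
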